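(* Let $A$ be a commutative ring and $\sigma$ a hereditary torsion theory in the category of $A$-modules. If $A$ is a totally $\sigma$-noetherian ring, then $\sigma$ is of finite type.
   Context: Rings are commutative with unit. A hereditary torsion theory $\sigma$ in the category of $A$-modules is given by its Gabriel filter $\mathcal{L}(\sigma)$: a non-empty filter of ideals of $A$ such that every ideal $\mathfrak{b}\subseteq A$ for which there exists $\mathfrak{a}\in\mathcal{L}(\sigma)$ with $(\mathfrak{b}:a)\in\mathcal{L}(\sigma)$ for every $a\in\mathfrak{a}$ belongs to $\mathcal{L}(\sigma)$. The theory $\sigma$ is of finite type if $\mathcal{L}(\sigma)$ has a filter basis of finitely generated ideals, i.e. every ideal in $\mathcal{L}(\sigma)$ contains a finitely generated ideal belonging to $\mathcal{L}(\sigma)$. An $A$-module $M$ is totally $\sigma$-torsion if there exists $\mathfrak{h}\in\mathcal{L}(\sigma)$ with $M\mathfrak{h}=0$. An ideal $\mathfrak{a}$ is totally $\sigma$-finitely generated if there is a finitely generated ideal $\mathfrak{a}'\subseteq\mathfrak{a}$ such that $\mathfrak{a}/\mathfrak{a}'$ is totally $\sigma$-torsion. The ring $A$ is totally $\sigma$-noetherian if every ideal of $A$ is totally $\sigma$-finitely generated. *)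

(* Defs.v *)
From HB Require Import structures.
From mathcomp Require Import all_boot all_algebra.
From mathcomp Require Import boolp classical_sets.

Set Implicit Arguments.
Unset Strict Implicit.
Unset Printing Implicit Defensive.

Import GRing.Theory.

Local Open Scope classical_set_scope.
Local Open Scope quotient_scope.
Local Open Scope ring_scope.

(** [A] is a [comPzRingType], so the zero ring is allowed. Ideals may be
    improper, unlike those of MathComp's [idealr], and need not be decidable. *)

Record ideal (A : comPzRingType) := Ideal {
  ideal_set :> set A;
  ideal0 : ideal_set 0;
  idealD : forall x y, ideal_set x -> ideal_set y -> ideal_set (x + y);
  idealMl : forall r x, ideal_set x -> ideal_set (r * x) }.

Section IdealOperations.
Variable A : comPzRingType.
Implicit Types a b : ideal A.

Definition ideal_meet a b : ideal A.
Proof.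
refine (@Ideal A (a `&` b) _ _ _).
- by split; apply: ideal0.
- by move=> x y [ax bx] [ay yb]; split; apply: idealD.
- by move=> r x [ax bx]; split; apply: idealMl.
Defined.

(** The colon ideal (b : x). *)
Definition ideal_colon b (x : A) : ideal A.
Proof.
refine (@Ideal A [set r | (b : set A) (r * x)] _ _ _) => /=.
- by rewrite mul0r; apply: ideal0.
- by move=> r s br bs; rewrite mulrDl; apply: idealD.
- by move=> r s bs; rewrite -mulrA; apply: idealMl.
Defined.

Definition finitely_generated a :=
  exists (n : nat) (g : 'I_n -> A),
    (a : set A) = [set x | exists c : 'I_n -> A, x = \sum_i c i * g i].

End IdealOperations.

(** The filter may contain the zero ideal. *)
Record hereditary_torsion_theory (A : comPzRingType) := HereditaryTorsionTheory {
  gabriel_filter : set (ideal A);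
  gabriel_nonempty : gabriel_filter !=set0;
  gabriel_upward : forall a b : ideal A,
    gabriel_filter a -> a `<=` b -> gabriel_filter b;
  gabriel_meet : forall a b : ideal A,
    gabriel_filter a -> gabriel_filter b -> gabriel_filter (ideal_meet a b);
  gabriel_colon : forall a b : ideal A,
    gabriel_filter a ->
    (forall x, (a : set A) x -> gabriel_filter (ideal_colon b x)) ->
    gabriel_filter b }.

Section QuotientModule.
Variables (A : pzRingType) (M : lmodType A) (N : submodClosed M).

(** [submodClosed] carries no closure under opposite, which
    [{ideal_quot _}] requires: it is recorded on this copy of [N]. *)
Definition submod_pred : {pred M} := [in N].
Fact submod_pred_zmod_closed : zmod_closed submod_pred.
Proof. exact: (GRing.submod_closedB (submodClosedP N)). Qed.
HB.instance Definition _ :=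
  GRing.isZmodClosed.Build M submod_pred submod_pred_zmod_closed.

Definition quotient_module : Type := {ideal_quot submod_pred}.
HB.instance Definition _ := GRing.Zmodule.on quotient_module.

Definition quotient_proj (x : M) : quotient_module :=
  \pi_{ideal_quot submod_pred} x.

Fact quotient_proj_surj u : exists x, u = quotient_proj x.
Proof.
by exists (repr (u : {ideal_quot submod_pred})); rewrite /quotient_proj reprK.
Qed.

Fact quotient_projD : {morph quotient_proj : x y / x + y}.
Proof. by move=> x y; rewrite /quotient_proj raddfD. Qed.

Fact quotient_proj_eq x y : (quotient_proj x == quotient_proj y) = (x - y \in N).
Proof. by rewrite -Quotient.idealrBE. Qed.

Definition quotient_scale (r : A) (u : quotient_module) : quotient_module :=
  quotient_proj (r *: repr (u : {ideal_quot submod_pred})).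

Fact quotient_projZ r x :
  quotient_scale r (quotient_proj x) = quotient_proj (r *: x).
Proof.
apply/eqP; rewrite quotient_proj_eq -scalerBr; apply: rpredZ.
by rewrite -quotient_proj_eq /quotient_proj reprK.
Qed.

Fact quotient_scaleA r s u :
  quotient_scale r (quotient_scale s u) = quotient_scale (r * s) u.
Proof. by have [x ->] := quotient_proj_surj u; rewrite !quotient_projZ scalerA. Qed.

Fact quotient_scale1 : left_id 1 quotient_scale.
Proof.
by move=> u; have [x ->] := quotient_proj_surj u; rewrite quotient_projZ scale1r.
Qed.

Fact quotient_scaleDr : right_distributive quotient_scale +%R.
Proof.
move=> r u v; have [x ->] := quotient_proj_surj u.
have [y ->] := quotient_proj_surj v.
by rewrite -quotient_projD !quotient_projZ -quotient_projD scalerDr.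
Qed.

Fact quotient_scaleDl u : {morph quotient_scale^~ u : r s / r + s}.
Proof.
move=> r s; have [x ->] := quotient_proj_surj u.
by rewrite !quotient_projZ scalerDl quotient_projD.
Qed.

HB.instance Definition _ := GRing.Zmodule_isLmodule.Build A quotient_module
  quotient_scaleA quotient_scale1 quotient_scaleDr quotient_scaleDl.

End QuotientModule.

Section IdealQuotient.
Variable A : comPzRingType.

Definition ideal_pred (a : ideal A) : {pred A^o} := fun x => x \in (a : set A).

Fact ideal_pred_submod_closed a : submod_closed (ideal_pred a).
Proof.
split=> [|r x y]; rewrite !unfold_in; first exact/mem_set/ideal0.
by move=> /set_mem ax /set_mem ay; apply/mem_set/idealD => //; apply: idealMl.
Qed.
HB.instance Definition _ a :=
  GRing.isSubmodClosed.Build A A^o (ideal_pred a) (ideal_pred_submod_closed a).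

(** The ideal [a], viewed as an [A]-module. *)
Definition ideal_module (a : ideal A) : Type := {x : A^o | ideal_pred a x}.
HB.instance Definition _ a := SubChoice.on (ideal_module a).
HB.instance Definition _ a :=
  [SubChoice_isSubLmodule of ideal_module a by <:].

(** [a' `&` a] as a submodule of [a]. *)
Definition ideal_in (a a' : ideal A) : {pred ideal_module a} :=
  fun u => ideal_pred a' (val u).
Arguments ideal_in a a' : clear implicits.

Fact ideal_in_submod_closed a a' : submod_closed (ideal_in a a').
Proof.
split=> [|r u v]; rewrite !unfold_in /ideal_in.
  by rewrite raddf0; apply: (rpred0 (ideal_pred a')).
by move=> a'u a'v; rewrite linearP; apply: (rpredD (S := ideal_pred a')) => //;
  apply: (rpredZ (s := ideal_pred a')).
Qed.
HB.instance Definition _ a a' := GRing.isSubmodClosed.Build A (ideal_module a)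
  (ideal_in a a') (ideal_in_submod_closed a a').

(** a / (a' `&` a), that is, a / a' when a' is contained in a. *)
Definition ideal_quotient (a a' : ideal A) : lmodType A :=
  quotient_module (ideal_in a a').

End IdealQuotient.

Arguments ideal_in {A} a a' _.

Section TorsionTheory.
Variables (A : comPzRingType) (sigma : hereditary_torsion_theory A).

Definition finite_type :=
  forall a : ideal A, gabriel_filter sigma a ->
    exists a' : ideal A,
      [/\ finitely_generated a', gabriel_filter sigma a' & a' `<=` a].

(** [M h = 0], where [M h] is the submodule generated by all [r *: m]. *)
Definition totally_torsion (M : lmodType A) :=
  exists2 h : ideal A, gabriel_filter sigma h &
    forall (m : M) (r : A), (h : set A) r -> r *: m = 0.

Definition totally_finitely_generated (a : ideal A) :=
  exists a' : ideal A,
    [/\ finitely_generated a', a' `<=` a &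
        totally_torsion (ideal_quotient a a')].

Definition totally_noetherian :=
  forall a : ideal A, totally_finitely_generated a.

End TorsionTheory.

(* Main.v *)
Require Import Defs.
From mathcomp Require Import all_boot all_algebra.
From mathcomp Require Import boolp classical_sets.

Import GRing.Theory.

Local Open Scope ring_scope.

(** If [a] is in the filter and [h], also in the filter, kills [a / a'], then
    [h] lies in [(a' : x)] for every [x] in [a], so the Gabriel condition puts
    the finitely generated ideal [a'] in the filter. *)

(** Apply [r] to the class of [x]: the class of [r * x] vanishes in the quotient exactly when
    [r * x] lies in [a']. *)
Lemma ideal_quotient_annihilated (A : comPzRingType) (a a' : ideal A) (r x : A) :
  (forall m : ideal_quotient a a', r *: m = 0) ->
  (a : set A) x -> (a' : set A) (r * x).
Proof.
move=> r0 ax; pose u : ideal_module a := exist _ x (mem_set ax).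
have := r0 (quotient_proj (ideal_in a a') u).
have -> : r *: quotient_proj (ideal_in a a') u
          = quotient_proj (ideal_in a a') (r *: u) by exact: quotient_projZ.
(* The projection preserves zero by additivity: cancel one copy of its value [p] at [0] from
   [p + 0 = p + p]. *)
have -> : 0 = quotient_proj (ideal_in a a') 0.
  by apply: (@addrI _ (quotient_proj _ 0)); rewrite -quotient_projD !addr0.
move=> /eqP; rewrite quotient_proj_eq subr0 => a'ru.
(* By conversion: the value of [r *: u] is [r * x], since scaling in [A^o] is multiplication. *)
exact: (set_mem (a'ru : r * x \in (a' : set A))).
Qed.

Theorem proposition3 (A : comPzRingType) (sigma : hereditary_torsion_theory A) :
  totally_noetherian sigma -> finite_type sigma.
Proof.
move=> noeth a La; have [a' [fg_a' a'a [h Lh h0]]] := noeth a.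
exists a'; split=> //; apply: (gabriel_colon La) => x ax.
apply: (gabriel_upward Lh) => r hr.
by apply: ideal_quotient_annihilated ax => m; apply: h0.
Qed.
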